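(* If an s-hypersequent $\alpha_1\vdash\beta_1\mid\dots\mid\alpha_n\vdash\beta_n$ is valid in the class $\mathcal{K}$ of all contexts, then it is provable in $\mathbf{PDBL}$.
   Context: The logic PDBL. Variables: object variables $\mathbf{OV}$ ($p,\dots$) and property variables $\mathbf{PV}$ ($P,\dots$), disjoint countably infinite sets; constants $\top,\bot$; connectives $\sqcap,\sqcup$ (binary), $\neg,\lrcorner$ (unary). $\alpha\vee\beta:=\neg(\neg\alpha\sqcap\neg\beta)$, $\alpha\wedge\beta:=\lrcorner(\lrcorner\alpha\sqcup\lrcorner\beta)$. Sequents $\alpha\vdash\beta$ ($\alpha\dashv\vdash\beta$ means both directions); s-hypersequents are finite sequences $\alpha_1\vdash\beta_1\mid\dots\mid\alpha_n\vdash\beta_n$ (components); $B,C,\dots,X$ range over possibly empty s-hypersequents. Axioms: $\alpha\vdash\alpha$; $\alpha\sqcap\beta\vdash\alpha$; $\alpha\sqcap\beta\vdash\beta$; $\alpha\vdash\alpha\sqcup\beta$; $\beta\vdash\alpha\sqcup\beta$; $\alpha\sqcap\beta\vdash(\alpha\sqcap\beta)\sqcap(\alpha\sqcap\beta)$; $(\alpha\sqcup\beta)\sqcup(\alpha\sqcup\beta)\vdash\alpha\sqcup\beta$; $\neg(\alpha\sqcap\alpha)\vdash\neg\alpha$; $\lrcorner\alpha\vdash\lrcorner(\alpha\sqcup\alpha)$; $\alpha\sqcap\neg\alpha\vdash\bot$; $\top\vdash\alpha\sqcup\lrcorner\alpha$; $\neg\neg(\alpha\sqcap\beta)\dashv\vdash\alpha\sqcap\beta$;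 $\lrcorner\lrcorner(\alpha\sqcup\beta)\dashv\vdash\alpha\sqcup\beta$; $\alpha\sqcap\alpha\vdash\alpha\sqcap(\alpha\sqcup\beta)$; $\alpha\sqcup(\alpha\sqcap\beta)\vdash\alpha\sqcup\alpha$; $\alpha\sqcap\alpha\vdash\alpha\sqcap(\alpha\vee\beta)$; $\alpha\sqcup(\alpha\wedge\beta)\vdash\alpha\sqcup\alpha$; $\alpha\sqcap(\beta\vee\gamma)\dashv\vdash(\alpha\sqcap\beta)\vee(\alpha\sqcap\gamma)$; $\alpha\sqcup(\beta\wedge\gamma)\dashv\vdash(\alpha\sqcup\beta)\wedge(\alpha\sqcup\gamma)$; $\bot\vdash\alpha$; $\alpha\vdash\top$; $\neg\top\vdash\bot$; $\top\vdash\lrcorner\bot$; $\neg\bot\dashv\vdash\top\sqcap\top$; $\lrcorner\top\dashv\vdash\bot\sqcup\bot$; $(\alpha\sqcup\alpha)\sqcap(\alpha\sqcup\alpha)\dashv\vdash(\alpha\sqcap\alpha)\sqcup(\alpha\sqcap\alpha)$; $p\sqcap p\dashv\vdash p$ ($p\in\mathbf{OV}$); $P\sqcup P\dashv\vdash P$ ($P\in\mathbf{PV}$); (Sp) $\alpha\vdash\alpha\sqcap\alpha\mid\alpha\sqcup\alpha\vdash\alpha$. Rules: from $B\mid\alpha\vdash\beta\mid C$ infer $B\mid\alpha\sqcap\gamma\vdash\beta\sqcap\gamma\mid C$, $B\mid\gamma\sqcap\alpha\vdash\gamma\sqcap\beta\mid C$, $B\mid\alpha\sqcup\gamma\vdash\beta\sqcup\gamma\mid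 C$, $B\mid\gamma\sqcup\alpha\vdash\gamma\sqcup\beta\mid C$, $B\mid\neg\beta\vdash\neg\alpha\mid C$, $B\mid\lrcorner\beta\vdash\lrcorner\alpha\mid C$; from $B\mid\alpha\vdash\beta\mid C$ and $D\mid\beta\vdash\gamma\mid E$ infer $B\mid D\mid\alpha\vdash\gamma\mid C\mid E$; from $B\mid\alpha\sqcap\beta\vdash\alpha\sqcap\alpha\mid C$, $D\mid\alpha\sqcap\alpha\vdash\alpha\sqcap\beta\mid E$, $F\mid\alpha\sqcup\beta\vdash\beta\sqcup\beta\mid G$, $H\mid\beta\sqcup\beta\vdash\alpha\sqcup\beta\mid X$ infer $B\mid D\mid F\mid H\mid\alpha\vdash\beta\mid C\mid E\mid G\mid X$; external: from $B\mid D\mid D\mid C$ infer $B\mid D\mid C$; from $B\mid D\mid E\mid C$ infer $B\mid E\mid D\mid C$; from $B$ infer $B\mid C$. Provability is via finite derivations. Contexts and semiconcepts. A context is $\mathbb{K}=(G,M,R)$ with sets $G$ (objects), $M$ (properties), $R\subseteq G\times M$. For $A\subseteq G$, $A'=\{m\in M:gRm\text{ for all }g\in A\}$; for $B\subseteq M$, $B'=\{g\in G:gRm\text{ for all }m\in B\}$. A semiconcept is a pair $(A,B)$ with $A'=B$ or $B'=A$; $\mathfrak{H}(\mathbb{K})$ is the set of semiconcepts, with $ext(A,B)=A$, $int(A,B)=B$, and operations $(A_1,B_1)\sqcap(A_2,B_2)=(A_1\cap A_2,(A_1\cap A_2)')$, $(A_1,B_1)\sqcup(A_2,B_2)=((B_1\cap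 B_2)',B_1\cap B_2)$, $\neg(A,B)=(G\setminus A,(G\setminus A)')$, $\lrcorner(A,B)=((M\setminus B)',M\setminus B)$, $\top=(G,\emptyset)$, $\bot=(\emptyset,M)$. Models. A model is $\mathbb{M}=(\mathbb{K},v)$ with $v$ a map on $\mathbf{OV}\cup\mathbf{PV}\cup\{\top,\bot\}$ into $\mathfrak{H}(\mathbb{K})$ with $v(p)\sqcap v(p)=v(p)$ for $p\in\mathbf{OV}$, $v(P)\sqcup v(P)=v(P)$ for $P\in\mathbf{PV}$, $v(\top)=(G,\emptyset)$, $v(\bot)=(\emptyset,M)$. Satisfaction $\mathbb{M},g\models\alpha$ ($g\in G$) and co-satisfaction $\mathbb{M},m\succ\alpha$ ($m\in M$) are defined by: $g\models p$ iff $g\in ext(v(p))$; $g\models P$ iff $g\in ext(v(P))$; $g\models\top$ always; $g\not\models\bot$ always; $m\not\succ\top$ always; $m\succ\bot$ always; $g\models\alpha\sqcap\beta$ iff $g\models\alpha$ and $g\models\beta$; $g\models\neg\alpha$ iff $g\not\models\alpha$; $m\succ p$ iff $m\in int(v(p))$; $m\succ P$ iff $m\in int(v(P))$; $m\succ\alpha\sqcup\beta$ iff $m\succ\alpha$ and $m\succ\beta$; $m\succ\lrcorner\alpha$ iff $m\not\succ\alpha$; $g\models\alpha\sqcup\beta$ iff for all $m\in M$ ($m\succ\alpha\sqcup\beta\Rightarrow gRm$); $g\models\lrcorner\alpha$ iff for all $m\in M$ ($m\not\succ\alpha\Rightarrow gRm$); $m\succ\neg\alpha$ iff for all $g\in G$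 ($g\not\models\alpha\Rightarrow gRm$); $m\succ\alpha\sqcap\beta$ iff for all $g\in G$ ($g\models\alpha\sqcap\beta\Rightarrow gRm$). A sequent $\alpha\vdash\beta$ is satisfied in $\mathbb{M}$ iff for all $g\in G$, $g\models\alpha$ implies $g\models\beta$, and for all $m\in M$, $m\succ\beta$ implies $m\succ\alpha$. An s-hypersequent is satisfied in $\mathbb{M}$ iff at least one component is; it is true in $\mathbb{K}$ iff satisfied in every model based on $\mathbb{K}$; valid in a class of contexts iff true in each member. *)

(* Defs.v *)
From mathcomp Require Import all_boot.
From mathcomp Require Import boolp classical_sets.
From Stdlib Require List.

Set Implicit Arguments.
Unset Strict Implicit.
Unset Printing Implicit Defensive.

Local Open Scope classical_set_scope.

Declare Scope pdbl_scope.
Delimit Scope pdbl_scope with PDBL.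

(** * Syntax *)

(* The domain of a valuation: two disjoint copies of [nat] as the object and
   the property variables, and the two constants. *)
Inductive atom : Type :=
| OV (p : nat)
| PV (P : nat)
| Top
| Bot.

Inductive formula : Type :=
| Atom (x : atom)
| Meet (a b : formula)
| Join (a b : formula)
| Neg (a : formula)
| Opp (a : formula).

Bind Scope pdbl_scope with formula.

Notation "⊤" := (Atom Top) : pdbl_scope.
Notation "⊥" := (Atom Bot) : pdbl_scope.
Notation "a ⊓ b" := (Meet a b) (at level 40, left associativity) : pdbl_scope.
Notation "a ⊔ b" := (Join a b) (at level 40, left associativity) : pdbl_scope.
Notation "¬ a" := (Neg a) (at level 35, right associativity) : pdbl_scope.
Notation "⌟ a" := (Opp a) (at level 35, right associativity) : pdbl_scope.

Local Open Scope pdbl_scope.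

Definition Vee (a b : formula) : formula := ¬ (¬ a ⊓ ¬ b).
Definition Wedge (a b : formula) : formula := ⌟ (⌟ a ⊔ ⌟ b).

Notation "a ∨ b" := (Vee a b) (at level 40, left associativity) : pdbl_scope.
Notation "a ∧ b" := (Wedge a b) (at level 40, left associativity) : pdbl_scope.

Record sequent : Type := Sequent { lhs : formula; rhs : formula }.

Notation "a ⊢ b" := (Sequent a b) (at level 70, no associativity) : pdbl_scope.

(* The list [[:: S_1; ...; S_n]] stands for [S_1 | ... | S_n]. *)
Definition hypersequent : Type := seq sequent.

(** * The calculus PDBL *)

(* The axioms having a single component. *)
Inductive axiom : sequent -> Prop :=
| ax_id a : axiom (a ⊢ a)
| ax_meetl a b : axiom (a ⊓ b ⊢ a)
| ax_meetr a b : axiom (a ⊓ b ⊢ b)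
| ax_joinl a b : axiom (a ⊢ a ⊔ b)
| ax_joinr a b : axiom (b ⊢ a ⊔ b)
| ax_meet_idem a b : axiom (a ⊓ b ⊢ (a ⊓ b) ⊓ (a ⊓ b))
| ax_join_idem a b : axiom ((a ⊔ b) ⊔ (a ⊔ b) ⊢ a ⊔ b)
| ax_neg_meet a : axiom (¬ (a ⊓ a) ⊢ ¬ a)
| ax_opp_join a : axiom (⌟ a ⊢ ⌟ (a ⊔ a))
| ax_meet_neg a : axiom (a ⊓ ¬ a ⊢ ⊥)
| ax_join_opp a : axiom (⊤ ⊢ a ⊔ ⌟ a)
| ax_negneg_l a b : axiom (¬ ¬ (a ⊓ b) ⊢ a ⊓ b)
| ax_negneg_r a b : axiom (a ⊓ b ⊢ ¬ ¬ (a ⊓ b))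
| ax_oppopp_l a b : axiom (⌟ ⌟ (a ⊔ b) ⊢ a ⊔ b)
| ax_oppopp_r a b : axiom (a ⊔ b ⊢ ⌟ ⌟ (a ⊔ b))
| ax_meet_join a b : axiom (a ⊓ a ⊢ a ⊓ (a ⊔ b))
| ax_join_meet a b : axiom (a ⊔ (a ⊓ b) ⊢ a ⊔ a)
| ax_meet_vee a b : axiom (a ⊓ a ⊢ a ⊓ (a ∨ b))
| ax_join_wedge a b : axiom (a ⊔ (a ∧ b) ⊢ a ⊔ a)
| ax_meet_distr_l a b c : axiom (a ⊓ (b ∨ c) ⊢ (a ⊓ b) ∨ (a ⊓ c))
| ax_meet_distr_r a b c : axiom ((a ⊓ b) ∨ (a ⊓ c) ⊢ a ⊓ (b ∨ c))
| ax_join_distr_l a b c : axiom (a ⊔ (b ∧ c) ⊢ (a ⊔ b) ∧ (a ⊔ c))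
| ax_join_distr_r a b c : axiom ((a ⊔ b) ∧ (a ⊔ c) ⊢ a ⊔ (b ∧ c))
| ax_bot a : axiom (⊥ ⊢ a)
| ax_top a : axiom (a ⊢ ⊤)
| ax_neg_top : axiom (¬ ⊤ ⊢ ⊥)
| ax_opp_bot : axiom (⊤ ⊢ ⌟ ⊥)
| ax_neg_bot_l : axiom (¬ ⊥ ⊢ ⊤ ⊓ ⊤)
| ax_neg_bot_r : axiom (⊤ ⊓ ⊤ ⊢ ¬ ⊥)
| ax_opp_top_l : axiom (⌟ ⊤ ⊢ ⊥ ⊔ ⊥)
| ax_opp_top_r : axiom (⊥ ⊔ ⊥ ⊢ ⌟ ⊤)
| ax_mixed_l a : axiom ((a ⊔ a) ⊓ (a ⊔ a) ⊢ (a ⊓ a) ⊔ (a ⊓ a))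
| ax_mixed_r a : axiom ((a ⊓ a) ⊔ (a ⊓ a) ⊢ (a ⊔ a) ⊓ (a ⊔ a))
| ax_OV_l p : axiom (Atom (OV p) ⊓ Atom (OV p) ⊢ Atom (OV p))
| ax_OV_r p : axiom (Atom (OV p) ⊢ Atom (OV p) ⊓ Atom (OV p))
| ax_PV_l P : axiom (Atom (PV P) ⊔ Atom (PV P) ⊢ Atom (PV P))
| ax_PV_r P : axiom (Atom (PV P) ⊢ Atom (PV P) ⊔ Atom (PV P)).

Inductive provable : hypersequent -> Prop :=
| pr_axiom S : axiom S -> provable [:: S]
| pr_Sp a : provable [:: a ⊢ a ⊓ a; a ⊔ a ⊢ a]
| pr_meetl B C a b c :
    provable (B ++ [:: a ⊢ b] ++ C) -> provable (B ++ [:: a ⊓ c ⊢ b ⊓ c] ++ C)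
| pr_meetr B C a b c :
    provable (B ++ [:: a ⊢ b] ++ C) -> provable (B ++ [:: c ⊓ a ⊢ c ⊓ b] ++ C)
| pr_joinl B C a b c :
    provable (B ++ [:: a ⊢ b] ++ C) -> provable (B ++ [:: a ⊔ c ⊢ b ⊔ c] ++ C)
| pr_joinr B C a b c :
    provable (B ++ [:: a ⊢ b] ++ C) -> provable (B ++ [:: c ⊔ a ⊢ c ⊔ b] ++ C)
| pr_neg B C a b :
    provable (B ++ [:: a ⊢ b] ++ C) -> provable (B ++ [:: ¬ b ⊢ ¬ a] ++ C)
| pr_opp B C a b :
    provable (B ++ [:: a ⊢ b] ++ C) -> provable (B ++ [:: ⌟ b ⊢ ⌟ a] ++ C)
| pr_cut B C D E a b c :
    provable (B ++ [:: a ⊢ b] ++ C) ->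
    provable (D ++ [:: b ⊢ c] ++ E) ->
    provable (B ++ D ++ [:: a ⊢ c] ++ C ++ E)
| pr_order B C D E F G H X a b :
    provable (B ++ [:: a ⊓ b ⊢ a ⊓ a] ++ C) ->
    provable (D ++ [:: a ⊓ a ⊢ a ⊓ b] ++ E) ->
    provable (F ++ [:: a ⊔ b ⊢ b ⊔ b] ++ G) ->
    provable (H ++ [:: b ⊔ b ⊢ a ⊔ b] ++ X) ->
    provable (B ++ D ++ F ++ H ++ [:: a ⊢ b] ++ C ++ E ++ G ++ X)
| pr_contraction B C D :
    provable (B ++ D ++ D ++ C) -> provable (B ++ D ++ C)
| pr_exchange B C D E :
    provable (B ++ D ++ E ++ C) -> provable (B ++ E ++ D ++ C)
| pr_weakening B C :
    provable B -> provable (B ++ C).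

(** * Contexts and semiconcepts *)

Record context : Type := Context {
  obj : Type;
  prop : Type;
  rel : obj -> prop -> Prop
}.

Section Semiconcepts.
Variable K : context.
Implicit Types (A : set (obj K)) (B : set (prop K)).

Definition intent A : set (prop K) := [set m | forall g, A g -> rel g m].
Definition extent B : set (obj K) := [set g | forall m, B m -> rel g m].

Definition semiconcepts : set (set (obj K) * set (prop K)) :=
  [set X | intent X.1 = X.2 \/ extent X.2 = X.1].

Implicit Types X Y : set (obj K) * set (prop K).

Definition sc_meet X Y : set (obj K) * set (prop K) :=
  (X.1 `&` Y.1, intent (X.1 `&` Y.1)).
Definition sc_join X Y : set (obj K) * set (prop K) :=
  (extent (X.2 `&` Y.2), X.2 `&` Y.2).
Definition sc_top : set (obj K) * set (prop K) := (setT, set0).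
Definition sc_bot : set (obj K) * set (prop K) := (set0, setT).

End Semiconcepts.

(** * Models *)

(* The models based on [K]. *)
Record model (K : context) : Type := Model {
  val : atom -> set (obj K) * set (prop K);
  val_semiconcept : forall x, semiconcepts (val x);
  val_OV : forall p, sc_meet (val (OV p)) (val (OV p)) = val (OV p);
  val_PV : forall P, sc_join (val (PV P)) (val (PV P)) = val (PV P);
  val_top : val Top = sc_top K;
  val_bot : val Bot = sc_bot K
}.

Section Satisfaction.
Variables (K : context) (M : model K).

(* To keep the recursion structural, [cosat (a ⊔ b) m] in the clause for
   [sat (a ⊔ b)] and [sat (a ⊓ b) g] in the clause for [cosat (a ⊓ b)] are
   written unfolded; see [sat_join] and [cosat_meet]. *)
Fixpoint sat (a : formula) (g : obj K) {struct a} : Prop :=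
  match a with
  | Atom Top => True
  | Atom Bot => False
  | Atom x => (val M x).1 g
  | a ⊓ b => sat a g /\ sat b g
  | ¬ a => ~ sat a g
  | a ⊔ b => forall m, cosat a m /\ cosat b m -> rel g m
  | ⌟ a => forall m, ~ cosat a m -> rel g m
  end
with cosat (a : formula) (m : prop K) {struct a} : Prop :=
  match a with
  | Atom Top => False
  | Atom Bot => True
  | Atom x => (val M x).2 m
  | a ⊔ b => cosat a m /\ cosat b m
  | ⌟ a => ~ cosat a m
  | ¬ a => forall g, ~ sat a g -> rel g m
  | a ⊓ b => forall g, sat a g /\ sat b g -> rel g m
  end.

Lemma sat_join a b g : sat (a ⊔ b) g <-> forall m, cosat (a ⊔ b) m -> rel g m.
Proof. by []. Qed.

Lemma cosat_meet a b m : cosat (a ⊓ b) m <-> forall g, sat (a ⊓ b) g -> rel g m.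
Proof. by []. Qed.

Definition sequent_sat (S : sequent) : Prop :=
  (forall g, sat (lhs S) g -> sat (rhs S) g) /\
  (forall m, cosat (rhs S) m -> cosat (lhs S) m).

Definition hypersequent_sat (H : hypersequent) : Prop :=
  List.Exists sequent_sat H.

End Satisfaction.

Definition true_in (K : context) (H : hypersequent) : Prop :=
  forall M : model K, hypersequent_sat M H.

Definition valid (C : context -> Prop) (H : hypersequent) : Prop :=
  forall K, C K -> true_in K H.

Definition all_contexts : context -> Prop := fun _ => True.

(* Main.v *)
(* The canonical model. Write [a ≤ b] when [a ⊢ b] is provable. The laws of
   [⊓] and [¬] make the classes of formulas with [a ≤ a ⊓ a] a Boolean algebra,
   and dually for [⊔] and [⌟]. Objects are the primary filters, properties
   the primary ideals, and a filter is related to an ideal when they intersect.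
   By the prime filter theorem satisfaction is membership, and the order rule
   then shows that every sequent satisfied in this single model is provable on
   its own. So a valid hypersequent has a provable component, and it
   follows by weakening. *)
From mathcomp Require Import all_boot.
From mathcomp Require Import boolp classical_sets.
From Stdlib Require List.
Require Import Defs.

Set Implicit Arguments.
Unset Strict Implicit.
Unset Printing Implicit Defensive.

Local Open Scope classical_set_scope.

(* One half of a double Boolean algebra: the laws that relate [meet] and [neg],
   the join being definable. The other half satisfies them for the reverse
   order. *)
Record half_boolean (T : Type) (le : T -> T -> Prop) (meet : T -> T -> T)
    (neg : T -> T) (top bot : T) : Prop := HalfBoolean {
  hb_refl : forall a, le a a;
  hb_trans : forall b a c, le a b -> le b c -> le a c;
  hb_meetl : forall a b, le (meet a b) a;
  hb_meetr : forall a b, le (meet a b) b;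
  hb_meet_mono : forall a b c d,
    le a b -> le c d -> le (meet a c) (meet b d);
  hb_meet_idem : forall a b, le (meet a b) (meet (meet a b) (meet a b));
  hb_neg_mono : forall a b, le a b -> le (neg b) (neg a);
  hb_neg_meet : forall a, le (neg (meet a a)) (neg a);
  hb_meet_neg : forall a, le (meet a (neg a)) bot;
  hb_negneg : forall a b, le (neg (neg (meet a b))) (meet a b);
  hb_distr : forall a b c,
    le (meet a (neg (meet (neg b) (neg c))))
       (neg (meet (neg (meet a b)) (neg (meet a c))));
  hb_top : forall a, le a top;
  hb_bot : forall a, le bot a;
  hb_neg_bot : le (meet top top) (neg bot)
}.

Record primary_filter (T : Type) (le : T -> T -> Prop) (meet : T -> T -> T)
    (neg : T -> T) (bot : T) (F : set T) : Prop := PrimaryFilter {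
  pf_up : forall a b, le a b -> F a -> F b;
  pf_meet : forall a b, F a -> F b -> F (meet a b);
  pf_bot : ~ F bot;
  pf_neg : forall a, F a \/ F (neg a)
}.

(** * Prime filters in one Boolean half *)

Section HalfBoolean.
Variables (T : Type) (le : T -> T -> Prop) (meet : T -> T -> T).
Variables (neg : T -> T) (top bot : T).
Hypothesis hb : half_boolean le meet neg top bot.

Let vee a b := neg (meet (neg a) (neg b)).
Let primary := primary_filter le meet neg bot.

Lemma le_meet_idem a b c : le a (meet a a) -> le a b -> le a c -> le a (meet b c).
Proof. by move=> aa ab ac; apply: (hb_trans hb aa); apply: (hb_meet_mono hb). Qed.

(** [neg] cannot tell [a] from [meet a a], and double negation is removable on meets. *)
Lemma negneg_le a : le (neg (neg a)) (meet a a).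
Proof.
apply: (hb_trans hb _ (hb_negneg hb a a)); apply: (hb_neg_mono hb).
exact: (hb_neg_meet hb).
Qed.

Lemma neg_idem a : le (neg a) (meet (neg a) (neg a)).
Proof.
apply: (hb_trans hb _ (negneg_le (neg a))); apply: (hb_neg_mono hb).
exact: (hb_trans hb (negneg_le a) (hb_meetl hb a a)).
Qed.

(** By contraposition [neg z] lies below [neg a] and [neg b], hence, being idempotent, below their
    meet; negating again gives [neg (neg z)], which lies below [z]. *)
Lemma vee_le a b z : le (meet a a) z -> le (meet b b) z -> le (vee a b) z.
Proof.
have neg_le x : le (meet x x) z -> le (neg z) (neg x).
  by move=> xz; apply: (hb_trans hb _ (hb_neg_meet hb x)); apply: (hb_neg_mono hb).
move=> /neg_le az /neg_le bz.
apply: (hb_trans hb _ (hb_trans hb (negneg_le z) (hb_meetl hb z z))).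
by apply: (hb_neg_mono hb); apply: le_meet_idem => //; apply: neg_idem.
Qed.

Lemma le_excluded_middle a : le (meet top top) (vee a (neg a)).
Proof.
by apply: (hb_trans hb (hb_neg_bot hb)); apply: (hb_neg_mono hb);
   apply: (hb_meet_neg hb).
Qed.

(** A maximal filter containing [c] and avoiding the ideal [J] is primary. The hypothesis concerns
    [meet c c] because every filter containing [c] contains it, while [c] need not lie below it. *)
Theorem prime_filter (J : set T) (c : T) :
  J bot -> (forall a b, le a b -> J b -> J a) ->
  (forall a b, J a -> J b -> J (vee a b)) -> ~ J (meet c c) ->
  exists F, [/\ primary F, F c & forall a, F a -> ~ J a].
Proof.
move=> Jbot Jdown Jvee Jc.
(* The empty set is admitted only to bound the empty chain. *)
pose P (A : set T) := [/\ forall a b, le a b -> A a -> A b,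
  forall a b, A a -> A b -> A (meet a b),
  forall a, A a -> ~ J a & forall a, A a -> A c].
have [C CP Ctot|F [[Fup Fmeet FJ Fne] Fmax]] := @Zorn_bigcup T P.
  split=> [a b ab [A CA Aa]|a b [A CA Aa] [B CB Bb]|a [A CA Aa]|a [A CA Aa]].
  - by exists A => //; case: (CP A CA) => up _ _ _; apply: up Aa.
  - have [AB|BA] := Ctot A B CA CB.
      by exists B => //; case: (CP B CB) => _ m _ _; apply: m => //; apply: AB.
    by exists A => //; case: (CP A CA) => _ m _ _; apply: m => //; apply: BA.
  - by case: (CP A CA) => _ _ d _; apply: d.
  - by exists A => //; case: (CP A CA) => _ _ _ d; apply: d Aa.
have Fc : F c.
  (* Without [c] the set [F] would be empty, so the filter generated by [c] would properly extend
     it. *)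
  apply: contrapT => nFc; apply: (Fmax [set a | le (meet c c) a]).
    split=> [a /Fne //|sub]; apply: nFc; apply: sub; exact: (hb_meetl hb c c).
  split=> [a b ab ca|a b|a ca Ja|a _] /=.
  - exact: (hb_trans hb ca ab).
  - by apply: le_meet_idem; apply: (hb_meet_idem hb).
  - by apply: Jc; apply: (Jdown _ _ ca Ja).
  - exact: (hb_meetl hb c c).
exists F; split=> //; split=> // [Fbot|x]; first exact: FJ Fbot Jbot.
(* Otherwise the filter generated by [F] and [y] would avoid [J], against maximality. *)
have meetJ y : ~ F y -> exists2 f, F f & J (meet f y).
  move=> nFy; apply: contrapT => noJ.
  apply: (Fmax [set a | exists2 f, F f & le (meet f y) a]).
    split=> [a Fa|sub]; first by exists a => //; apply: (hb_meetl hb).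
    by apply: nFy; apply: sub; exists c => //; apply: (hb_meetr hb).
  split=> [a b ab [f Ff fa]|a b [f Ff fa] [g Fg gb]|a [f Ff fa] Ja|a _].
  - by exists f => //; apply: (hb_trans hb fa ab).
  - exists (meet f g); first exact: Fmeet.
    apply: le_meet_idem; first exact: (hb_meet_idem hb).
      apply: (hb_trans hb _ fa); apply: (hb_meet_mono hb);
        [exact: (hb_meetl hb)|exact: (hb_refl hb)].
    apply: (hb_trans hb _ gb); apply: (hb_meet_mono hb);
      [exact: (hb_meetr hb)|exact: (hb_refl hb)].
  - by apply: noJ; exists f => //; apply: (Jdown _ _ fa Ja).
  - by exists c => //; apply: (hb_meetl hb).
apply: contrapT => /not_orP[/meetJ[f Ff Jf] /meetJ[g Fg Jg]].
have Ftop : F top by apply: (Fup _ _ _ Fc); apply: (hb_top hb).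
(* By distributivity and excluded middle this element is in [F]; both its disjuncts are in [J]. *)
apply: (FJ (vee (meet (meet f g) x) (meet (meet f g) (neg x)))).
  apply: (Fup _ _ (hb_distr hb _ _ _)); apply: (Fmeet); first exact: Fmeet.
  by apply: (Fup _ _ (le_excluded_middle x)); apply: Fmeet.
apply: Jvee; [apply: (Jdown _ _ _ Jf)|apply: (Jdown _ _ _ Jg)]; apply: (hb_meet_mono hb);
  by [apply: (hb_meetl hb)|apply: (hb_meetr hb)|apply: (hb_refl hb)].
Qed.

Lemma primary_top F : primary F -> F top.
Proof. by case=> up _ _ /(_ top) [//|]; apply: up; apply: (hb_top hb). Qed.

Lemma primary_meetE F a b : primary F -> F (meet a b) <-> F a /\ F b.
Proof.
case=> up m _ _; split=> [Fab|[]]; last exact: m.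
by split; apply: (up _ _ _ Fab); [apply: (hb_meetl hb)|apply: (hb_meetr hb)].
Qed.

Lemma primary_negE F a : primary F -> F (neg a) <-> ~ F a.
Proof.
case=> up m nbot n; split=> [Fna Fa|nFa]; last by case: (n a).
by apply: nbot; apply: (up _ _ (hb_meet_neg hb a)); apply: m.
Qed.

Lemma primary_le a b :
  (forall F, primary F -> F a -> F b) -> le (meet a a) (meet a b).
Proof.
move=> ab; apply: contrapT => nab.
(* This ideal contains [b], so a filter through [a] avoiding it separates [a] from [b]. *)
have [| | | |F [pF Fa]] := @prime_filter [set x | le (meet x x) b] a.
- exact: (hb_trans hb (hb_meetl hb _ _) (hb_bot hb b)).
- move=> x y xy; apply: (hb_trans hb); exact: (hb_meet_mono hb).
- by move=> x y xb yb; apply: (hb_trans hb (hb_meetl hb _ _)); apply: vee_le.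
- move=> /(hb_trans hb (hb_meet_idem hb a a)) aab; apply: nab.
  apply: le_meet_idem => //; [exact: (hb_meet_idem hb)|exact: (hb_meetl hb)].
- by move=> /(_ b (ab F pF Fa)); apply; apply: (hb_meetl hb).
Qed.

(** This links the two halves: [J] is an ideal for the other half's [join]. As [join x y] bounds [x]
    and [y], [vee x y] lies below it for [x], [y] in [J], so the prime filter theorem applies to
    [J]. *)
Lemma primary_meets_ideal (J : set T) (join : T -> T -> T) a :
  le a (meet a a) -> J bot -> (forall x y, le x y -> J y -> J x) ->
  (forall x y, le x (join x y)) -> (forall x y, le y (join x y)) ->
  (forall x y, J x -> J y -> J (join x y)) ->
  (forall F, primary F -> F a -> exists2 x, F x & J x) -> J a.
Proof.
move=> aa Jbot Jdown jl jr Jjoin meetsJ; apply: contrapT => nJa.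
have [//|//| |/(Jdown _ _ aa)//|F [pF Fa FJ]] := @prime_filter J a.
  move=> x y Jx Jy; apply: (Jdown _ _ _ (Jjoin x y Jx Jy)).
  by apply: vee_le; apply: (hb_trans hb (hb_meetl hb _ _)).
by have [x /FJ] := meetsJ F pF Fa.
Qed.

End HalfBoolean.

Local Open Scope pdbl_scope.

(** * Provable sequents as two Boolean halves *)

Definition entails (a b : formula) : Prop := provable [:: a ⊢ b].

Lemma entails_trans b a c : entails a b -> entails b c -> entails a c.
Proof. exact: (@pr_cut [::] [::] [::] [::]). Qed.

Lemma entails_meet a b c d : entails a b -> entails c d -> entails (a ⊓ c) (b ⊓ d).
Proof.
move=> ab cd; apply: (@entails_trans (b ⊓ c)).
  exact: (@pr_meetl [::] [::]).
exact: (@pr_meetr [::] [::]).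
Qed.

Lemma entails_join a b c d : entails a b -> entails c d -> entails (a ⊔ c) (b ⊔ d).
Proof.
move=> ab cd; apply: (@entails_trans (b ⊔ c)).
  exact: (@pr_joinl [::] [::]).
exact: (@pr_joinr [::] [::]).
Qed.

Lemma entails_ax a b : axiom (a ⊢ b) -> entails a b.
Proof. exact: pr_axiom. Qed.

Lemma meet_half_boolean : half_boolean entails Meet Neg (Atom Top) (Atom Bot).
Proof.
split; try by move=> *; apply: entails_ax; constructor.
- exact: entails_trans.
- exact: entails_meet.
- by move=> a b; apply: (@pr_neg [::] [::]).
Qed.

Lemma join_half_boolean :
  half_boolean (fun a b => entails b a) Join Opp (Atom Bot) (Atom Top).
Proof.
split; try by move=> *; apply: entails_ax; constructor.
- by move=> b a c ba cb; apply: entails_trans cb ba.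
- by move=> a b c d; apply: entails_join.
- by move=> a b; apply: (@pr_opp [::] [::]).
Qed.

(** * Canonical context and valuation *)

Definition filter_set : set (set formula) :=
  primary_filter entails Meet Neg (Atom Bot).
Definition ideal_set : set (set formula) :=
  primary_filter (fun a b => entails b a) Join Opp (Atom Top).

Definition canonical_context : context :=
  @Context {F | filter_set F} {I | ideal_set I}
    (fun F I => exists2 a, sval F a & sval I a).

Definition filters_of (a : formula) : set (obj canonical_context) :=
  [set F | sval F a].
Definition ideals_of (a : formula) : set (prop canonical_context) :=
  [set I | sval I a].

(** An ideal that meets every primary filter through [a] must contain [a], by the prime filter
    theorem; conversely [a] itself is the common element. *)
Lemma intent_filters_of a : entails a (a ⊓ a) -> intent (filters_of a) = ideals_of a.
Proof.
move=> aa; apply/seteqP; split=> [[I pI] meetsI|I Ia F Fa]; last by exists a.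
have [up m _ _] := pI.
apply: (primary_meets_ideal meet_half_boolean (join := Join)) => //.
- exact: (primary_top join_half_boolean pI).
- by move=> x y; apply: up.
- by move=> x y; apply: entails_ax; constructor.
- by move=> x y; apply: entails_ax; constructor.
- by move=> F pF Fa; have [x] := meetsI (exist _ F pF) Fa; exists x.
Qed.

Lemma extent_ideals_of a : entails (a ⊔ a) a -> extent (ideals_of a) = filters_of a.
Proof.
move=> aa; apply/seteqP; split=> [[F pF] meetsF|F Fa I Ia]; last by exists a.
have [up m _ _] := pF.
apply: (primary_meets_ideal join_half_boolean (join := Meet)) => //.
- exact: (primary_top meet_half_boolean pF).
- by move=> x y; apply: up.
- by move=> x y; apply: entails_ax; constructor.
- by move=> x y; apply: entails_ax; constructor.
- by move=> I pI Ia; have [x] := meetsF (exist _ I pI) Ia; exists x.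
Qed.

Definition canonical_val (x : atom) := (filters_of (Atom x), ideals_of (Atom x)).

Lemma canonical_val_semiconcept x : semiconcepts (canonical_val x).
Proof.
(* [⊤] is treated like a property variable, through [⊤ ⊔ ⊤ ⊢ ⊤], and [⊥] like an object variable,
   through [⊥ ⊢ ⊥ ⊓ ⊥]. *)
case: x => [p|P||]; [left|right|right|left];
  by [apply: intent_filters_of; apply: entails_ax; constructor
     |apply: extent_ideals_of; apply: entails_ax; constructor].
Qed.

Lemma canonical_val_OV p :
  sc_meet (canonical_val (OV p)) (canonical_val (OV p)) = canonical_val (OV p).
Proof.
by rewrite /sc_meet setIid intent_filters_of //; apply: entails_ax; constructor.
Qed.

Lemma canonical_val_PV P :
  sc_join (canonical_val (PV P)) (canonical_val (PV P)) = canonical_val (PV P).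
Proof.
by rewrite /sc_join setIid extent_ideals_of //; apply: entails_ax; constructor.
Qed.

Lemma canonical_val_top : canonical_val Top = sc_top canonical_context.
Proof.
congr (_, _); apply/seteqP; split=> // -[X pX].
  by move=> _; exact: (primary_top meet_half_boolean pX).
exact: (pf_bot pX).
Qed.

Lemma canonical_val_bot : canonical_val Bot = sc_bot canonical_context.
Proof.
congr (_, _); apply/seteqP; split=> // -[X pX].
  exact: (pf_bot pX).
by move=> _; exact: (primary_top join_half_boolean pX).
Qed.

(** * Truth lemma and completeness *)

Definition canonical_model : model canonical_context :=
  Model canonical_val_semiconcept canonical_val_OV canonical_val_PV
    canonical_val_top canonical_val_bot.

(** For each connective one coordinate follows from primariness; the other is its intent or extent,
    and is identified because compound formulas are idempotent for [⊓] or [⊔]. Both are proved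
    together since [sat] and [cosat] are mutually recursive. *)
Lemma canonical_truth a :
  sat canonical_model a = filters_of a /\ cosat canonical_model a = ideals_of a.
Proof.
have neg_idem_entails := neg_idem meet_half_boolean.
have opp_idem_entails := neg_idem join_half_boolean.
elim: a => [x|a [sa ca] b [sb cb]|a [sa ca] b [sb cb]|a [sa ca]|a [sa ca]].
- have top := canonical_val_top; have bot := canonical_val_bot.
  case: x => //=; split; apply/funext => y.
  + by have /(congr1 (fun X => X.1 y)) /= -> := top.
  + by have /(congr1 (fun X => X.2 y)) /= -> := top.
  + by have /(congr1 (fun X => X.1 y)) /= -> := bot.
  + by have /(congr1 (fun X => X.2 y)) /= -> := bot.
- have sE : sat canonical_model (a ⊓ b) = filters_of (a ⊓ b).
    apply/funext => -[F pF]; apply/propext => /=; rewrite sa sb.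
    exact: iff_sym (primary_meetE meet_half_boolean a b pF).
  split=> //; rewrite -intent_filters_of -?sE //.
  by apply: entails_ax; constructor.
- have cE : cosat canonical_model (a ⊔ b) = ideals_of (a ⊔ b).
    apply/funext => -[I pI]; apply/propext => /=; rewrite ca cb.
    exact: iff_sym (primary_meetE join_half_boolean a b pI).
  split=> //; rewrite -extent_ideals_of -?cE //.
  by apply: entails_ax; constructor.
- have sE : sat canonical_model (¬ a) = filters_of (¬ a).
    apply/funext => -[F pF]; apply/propext => /=; rewrite sa.
    exact: iff_sym (primary_negE meet_half_boolean a pF).
  by split=> //; rewrite -intent_filters_of -?sE.
- have cE : cosat canonical_model (⌟ a) = ideals_of (⌟ a).
    apply/funext => -[I pI]; apply/propext => /=; rewrite ca.
    exact: iff_sym (primary_negE join_half_boolean a pI).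
  by split=> //; rewrite -extent_ideals_of -?cE.
Qed.

Lemma canonical_complete S : sequent_sat canonical_model S -> provable [:: S].
Proof.
case: S => a b [] /=; have [-> ->] := canonical_truth a.
have [-> ->] := canonical_truth b => ab ba.
have meet_ab : entails (a ⊓ a) (a ⊓ b).
  by apply: (primary_le meet_half_boolean) => F pF; apply: (ab (exist _ F pF)).
have join_ba : entails (b ⊔ a) (b ⊔ b).
  by apply: (primary_le join_half_boolean) => I pI; apply: (ba (exist _ I pI)).
(* [meet_ab] closes the second premise, and [join_ba] the third after commuting [⊔]; the other two
   hold for all [a] and [b]. *)
apply: (@pr_order [::] [::] [::] [::] [::] [::] [::] [::]) => //=.
- apply: (le_meet_idem meet_half_boolean);
    by apply: entails_ax; constructor.
- apply: entails_trans join_ba; apply: (le_meet_idem join_half_boolean);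
    by apply: entails_ax; constructor.
- apply: (le_meet_idem join_half_boolean);
    by apply: entails_ax; constructor.
Qed.

Lemma provable_mem S H : List.In S H -> provable [:: S] -> provable H.
Proof.
move=> SH pS; have [B [C ->]] := List.in_split S H SH.
exact/(@pr_exchange [::] C [:: S] B)/(@pr_weakening _ (B ++ C)).
Qed.

Theorem theorem67 (H : hypersequent) : valid all_contexts H -> provable H.
Proof.
move=> /(_ canonical_context I canonical_model) /List.Exists_exists[S [SH satS]].
exact: provable_mem SH (canonical_complete satS).
Qed.
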